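(* Let $\mathrm{Sort}(132)$ be the set of $132$-sortable permutations and let $\mu=\left(132,\{(0,2),(2,0),(2,1)\}\right)$. Then $\mathrm{Sort}(132)=\mathrm{Av}(2314,\mu)$; that is, a permutation is $132$-sortable if and only if it avoids both the classical pattern $2314$ and the mesh pattern $\mu$.
   Context: A permutation of length $n$ is written $\pi=\pi_1\cdots\pi_n$. It contains the classical pattern $\tau\in S_k$ if some subsequence of $\pi$ has the same relative order as $\tau$ (such a subsequence is an occurrence of $\tau$); otherwise it avoids $\tau$. The $132$-stack: a permutation $\pi$ is read from left to right and passed through an initially empty stack. At each step, the next input element is pushed onto the stack if the resulting content of the stack, read from top to bottom, avoids $132$; otherwise the top element of the stack is popped and appended to the output. When the input is exhausted, all remaining elements are popped to the output, from top to bottom. The output is denoted $s_{132}(\pi)$. The sequence $s_{132}(\pi)$ is then passed in the same way through a second stack, whose content read from top to bottom must avoid $21$. The permutation $\pi$ is $132$-sortable if the final output is the identity permutation; equivalently (a standard fact on stack sorting), if $s_{132}(\pi)$ avoids $231$. A mesh pattern of length $k$ is a pair $(\tau,A)$ with $\tau\in S_k$ and $A\subseteq[0,k]\times[0,k]$ a set of pairs of integers, the lower left corners of forbidden unit squares in the plot of $\tau$. An occurrence of $(\tau,A)$ in $\pi$ is an occurrence of $\tau$ in $\pi$ such that no element of $\pi$ lies in a region corresponding to a forbidden square. Concretely, an occurrence of $\mu$ is an occurrence $acb$ of $132$ in $\pi$ such that every element preceding $a$ in $\pi$ is either smaller than $b$ or greater than $c$, and every element located between $c$ and $b$ in $\pi$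 is greater than $b$. $\mathrm{Av}(2314,\mu)$ is the set of permutations with no occurrence of $2314$ and no occurrence of $\mu$. *)

(* Defs.v *)
From mathcomp Require Import all_boot all_fingroup.
Set Implicit Arguments.
Unset Strict Implicit.
Unset Printing Implicit Defensive.

(* Words are sequences of natural numbers; a permutation of length n, and a   *)
(* pattern, is written in one-line notation with the values 1, ..., n.        *)
Definition word (n : nat) (p : 'S_n) : seq nat :=
  [seq (val (p i)).+1 | i <- enum 'I_n].

Definition same_order (s t : seq nat) : bool :=
  (size s == size t) &&
  [forall i : 'I_(size t), forall j : 'I_(size t),
    (nth 0 s i < nth 0 s j) == (nth 0 t i < nth 0 t j)].

(* An occurrence in s is given by the bit mask m of its positions in s.       *)
Definition occurrence (tau s : seq nat) (m : bitseq) : bool :=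
  same_order (mask m s) tau.

Definition contains (tau s : seq nat) : bool :=
  [exists m : (size s).-tuple bool, occurrence tau s m].

Definition avoids (tau s : seq nat) : bool := ~~ contains tau s.

Record mesh_pattern := MeshPattern {
  mesh_perm : seq nat;
  mesh_squares : seq (nat * nat)
}.

(* Grid lines of the occurrence m in the plot of the word s, which is meant   *)
(* to be a permutation of 1, ..., size s plotted as the points (i, s_i) with  *)
(* i starting from 1.                                                         *)
Definition vlines (s : seq nat) (m : bitseq) : seq nat :=
  0 :: rcons (mask m (iota 1 (size s))) (size s).+1.

Definition hlines (s : seq nat) (m : bitseq) : seq nat :=
  0 :: rcons (sort leq (mask m s)) (size s).+1.

(* The region of the plot of s corresponding to the unit square whose lower   *)
(* left corner is q contains the point of abscissa i.                         *)
Definition in_region (s : seq nat) (m : bitseq) (q : nat * nat) (i : nat) :=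
  (nth 0 (vlines s m) q.1 < i < nth 0 (vlines s m) q.1.+1) &&
  (nth 0 (hlines s m) q.2 < nth 0 s i.-1 < nth 0 (hlines s m) q.2.+1).

Definition mesh_occurrence (P : mesh_pattern) (s : seq nat) (m : bitseq) :=
  occurrence (mesh_perm P) s m &&
  all (fun q => ~~ has (in_region s m q) (iota 1 (size s))) (mesh_squares P).

Definition mesh_contains (P : mesh_pattern) (s : seq nat) : bool :=
  [exists m : (size s).-tuple bool, mesh_occurrence P s m].

Definition mesh_avoids (P : mesh_pattern) (s : seq nat) : bool :=
  ~~ mesh_contains P s.

(* A stack is listed from top to bottom. [push tau x st] pops st until x can  *)
(* be pushed without creating tau; it returns the popped elements, in the     *)
(* order in which they are output, and the stack with x on top. Pushing on    *)
(* the empty stack is always allowed, as tau is meant to have length >= 2.    *)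
Fixpoint push (tau : seq nat) (x : nat) (st : seq nat) : seq nat * seq nat :=
  if st is y :: st' then
    if avoids tau (x :: st) then ([::], x :: st)
    else let: (out, st'') := push tau x st' in (y :: out, st'')
  else ([::], [:: x]).

Fixpoint run_stack (tau st input : seq nat) : seq nat :=
  if input is x :: input' then
    let: (out, st') := push tau x st in out ++ run_stack tau st' input'
  else st.

Definition stack_sort (tau s : seq nat) : seq nat := run_stack tau [::] s.

Definition sortable (tau s : seq nat) : bool :=
  stack_sort [:: 2; 1] (stack_sort tau s) == iota 1 (size s).

Definition Sort (n : nat) (tau : seq nat) : {set 'S_n} :=
  [set p : 'S_n | sortable tau (word p)].

Definition Av (n : nat) (tau : seq nat) (P : mesh_pattern) : {set 'S_n} :=
  [set p : 'S_n | avoids tau (word p) && mesh_avoids P (word p)].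

Definition mu : mesh_pattern :=
  MeshPattern [:: 1; 3; 2] [:: (0, 2); (2, 0); (2, 1)].

(* Main.v *)
Require Import Defs.
From mathcomp Require Import all_boot all_fingroup.
From mathcomp Require Import zify.
Set Implicit Arguments.
Unset Strict Implicit.
Unset Printing Implicit Defensive.

(** Let w be the permutation, read letter by letter.  Call a letter of w a
    left-to-right minimum if every earlier letter is larger.

    A left-to-right minimum x empties the first stack down to the previous
    left-to-right minimum m: an entry y > m lying above m would form the
    occurrence x y m of 132.  It then stays until the end, because
    the left-to-right minima are increasing from top to bottom and hence
    create no 132 with any new letter.  So the stack is always a body st on
    top of the increasing list ms of left-to-right minima, and if out is the
    output so far, the final output is D ++ ms, where D is the final value of
    out ++ st and ms starts with the minimum of w.

    The second stack sorts D ++ ms exactly when D is decreasing: an ascent of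
    D makes a letter leave before the minimum, which comes later, while a
    decreasing D is stored and then merged with ms ([run21_sorts]).

    It remains to see when D is decreasing.  Reading x only inserts x into
    out ++ st, or leaves this word as it is when x is a left-to-right minimum.
    Hence D is decreasing if and only if each insertion preserves this
    property.  As long as it holds, st consists of the letters, other than
    left-to-right minima, with no smaller letter after them, and out of those
    with a smaller letter after them ([reach_later]).  The insertion of x is
    correct when x is smaller than all of out, and all entries of st larger
    than x are popped.  By [body_push_decreasing], the latter means that every entry
    y > x of st has a left-to-right minimum strictly between x and y.  The two
    conditions say that no occurrence of 2314 and no occurrence of the
    mesh pattern ends with x ([reach_decreasing]), once all earlier
    occurrences are excluded. *)

(** * Words and the order of their letters *)

Lemma subseq_rcons2 (T : eqType) (s t : seq T) (x y : T) :
  subseq (rcons s y) (rcons t x) =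
  subseq (rcons s y) t || (y == x) && subseq s t.
Proof.
rewrite -[LHS]subseq_rev -[subseq (rcons s y) t]subseq_rev -[subseq s t]subseq_rev.
rewrite !rev_rcons /=; case: eqP => [->|_]; last by rewrite orbF.
by apply/esym/orb_idl => h; apply: subseq_trans h; apply: subseq_cons.
Qed.

Definition before (T : eqType) (p : seq T) (y z : T) := subseq [:: y; z] p.

Lemma before_rcons (T : eqType) (p : seq T) (x y z : T) :
  before (rcons p x) y z = before p y z || (z == x) && (y \in p).
Proof. by rewrite /before (subseq_rcons2 [:: y]) sub1seq. Qed.

Lemma before_mem (T : eqType) (p : seq T) (y z : T) :
  before p y z -> (y \in p) && (z \in p).
Proof. by move=> /mem_subseq h; rewrite !h ?inE ?eqxx ?orbT. Qed.

Lemma before_index (T : eqType) (p : seq T) (y z : T) : uniq p ->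
  before p y z = (z \in p) && (index y p < index z p).
Proof.
elim/last_ind: p => [|p x IH]; first by rewrite andbF.
rewrite rcons_uniq => /andP[xp up]; rewrite before_rcons IH // mem_rcons inE.
have ixp : index x (rcons p x) = size p by rewrite -cats1 index_cat (negbTE xp) /= eqxx addn0.
have iyp t : index t (rcons p x) = if t \in p then index t p else size p + (x != t).
  by rewrite -cats1 index_cat /= ; case: (x =P t).
rewrite !iyp; have [->|zx] /= := eqVneq z x.
  rewrite (negbTE xp) addn0; case yp: (y \in p); last by lia.
  by rewrite index_mem yp.
rewrite orbF; case zp: (z \in p) => //=; case: ifP => // yp.
by have := index_mem z p; rewrite zp (memNindex (negbT yp)); lia.
Qed.

Lemma before_total (T : eqType) (p : seq T) (y z : T) : uniq p ->
  y \in p -> z \in p -> y != z -> before p y z || before p z y.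
Proof.
move=> up yp zp; rewrite !before_index // yp zp /= -neq_ltn; apply: contra => /eqP.
by move/(index_inj y yp zp) => ->.
Qed.

Lemma before_trans (T : eqType) (p : seq T) (x y z : T) : uniq p ->
  before p x y -> before p y z -> before p x z.
Proof.
by move=> up; rewrite !before_index // => /andP[_ h] /andP[-> /(ltn_trans h)].
Qed.

Lemma before_neq (T : eqType) (p : seq T) (y z : T) : uniq p ->
  before p y z -> y != z.
Proof. by move=> up; rewrite before_index // => /andP[_]; apply: contraTneq => ->; rewrite ltnn. Qed.

Lemma before_cat (T : eqType) (s t : seq T) (y z : T) :
  before (s ++ t) y z = [|| before s y z, (y \in s) && (z \in t) | before t y z].
Proof.
elim/last_ind: t => [|t x IH]; first by rewrite cats0 andbF !orbF.
rewrite -rcons_cat !before_rcons IH mem_cat mem_rcons inE.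
case: (z == x); case: (y \in s); case: (y \in t) => //=;
  by case: (before s y z); case: (before t y z) => //=; case: (z \in t).
Qed.

(** Without repeated letters, the two embeddings must send y to the same
    position. *)
Lemma subseq_glue (T : eqType) (p s t : seq T) (y : T) : uniq p ->
  subseq (rcons s y) p -> subseq (y :: t) p -> subseq (s ++ y :: t) p.
Proof.
move=> up sp tp; have yp : y \in p by apply: (mem_subseq tp); rewrite mem_head.
case/splitPr: yp up sp tp => p1 p2 up sp tp.
move: up; rewrite cat_uniq /= negb_or => /and3P[_ /andP[yp1 _] /andP[yp2 _]].
have sp1 : subseq s p1.
  move: sp; rewrite -[s]revK -rev_cons -subseq_rev revK rev_cat rev_cons cat_rcons.
  rewrite -[subseq _ p1]subseq_rev revK.
  elim/last_ind: p2 yp2 {tp} => [|p2 z IH]; first by rewrite /= eqxx.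
  rewrite mem_rcons inE negb_or => /andP[/negbTE yz /IH h].
  by rewrite rev_rcons /= yz.
apply: cat_subseq => //=; rewrite eqxx.
elim: p1 yp1 tp {sp1 sp} => [|z p1 IH] /=; first by rewrite eqxx.
by rewrite inE negb_or => /andP[/negbTE-> /IH].
Qed.

Lemma before_glue (T : eqType) (p : seq T) (x y z : T) : uniq p ->
  before p x y -> before p y z -> subseq [:: x; y; z] p.
Proof. by move=> up; apply: (@subseq_glue _ _ [:: x] [:: z]). Qed.

Lemma subseq_cons_cons (T : eqType) (s t : seq T) (x y : T) :
  subseq (y :: s) (x :: t) = if y == x then subseq s t else subseq (y :: s) t.
Proof. by rewrite /=; case: ifP. Qed.

Lemma first_mem (P : pred nat) (p : seq nat) : uniq p -> has P p ->
  exists a, [/\ a \in p, P a & forall e, before p e a -> ~~ P e].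
Proof.
move=> up hasP_p; have lt := hasP_p; rewrite has_find in lt.
exists (nth 0 p (find P p)); split; [exact: mem_nth | exact: nth_find |].
move=> e ea; have /andP[ep _] := before_mem ea; move: ea.
by rewrite before_index // index_uniq // => /andP[_ /(before_find 0)]; rewrite nth_index // => ->.
Qed.

(** * Pattern containment *)

Lemma containsP (tau s : seq nat) :
  reflect (exists2 t, subseq t s & same_order t tau) (contains tau s).
Proof.
apply: (iffP existsP) => [[m om]|[t /subseqP[m /eqP sm ->] o]].
  by exists (mask m s) => //; apply: mask_subseq.
by exists (Tuple sm).
Qed.

(** Turns the quantifiers of [same_order] into conjunctions that compute on
    explicit patterns. *)
Lemma forall_ordE (n : nat) (P : pred nat) :
  [forall i : 'I_n, P i] = all P (iota 0 n).
Proof.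
apply/forallP/allP => [h i|h i]; last by apply: h; rewrite mem_iota ltn_ord.
by rewrite mem_iota => /andP[_ lt]; apply: (h (Ordinal lt)).
Qed.

Lemma same_orderE (s t : seq nat) : same_order s t =
  (size s == size t) &&
  all (fun i => all (fun j => (nth 0 s i < nth 0 s j) == (nth 0 t i < nth 0 t j))
    (iota 0 (size t))) (iota 0 (size t)).
Proof.
rewrite -forall_ordE; congr (_ && _); apply: eq_forallb => i.
by rewrite -forall_ordE.
Qed.

Lemma same_order21 (a b : nat) : same_order [:: a; b] [:: 2; 1] = (b < a).
Proof. by rewrite same_orderE /=; lia. Qed.

Lemma same_order132 (a c b : nat) :
  same_order [:: a; c; b] [:: 1; 3; 2] = (a < b < c).
Proof. rewrite same_orderE /=; lia. Qed.

Lemma same_order2314 (u v z x : nat) :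
  same_order [:: u; v; z; x] [:: 2; 3; 1; 4] = [&& z < u, u < v & v < x].
Proof. rewrite same_orderE /=; lia. Qed.

Lemma contains21P (s : seq nat) :
  reflect (exists a b, before s a b /\ b < a) (contains [:: 2; 1] s).
Proof.
apply: (iffP (containsP _ _)) => [[t ts o]|[a [b [ab lt]]]]; last first.
  by exists [:: a; b]; rewrite ?same_order21.
have/andP[/eqP sz _] := o; case: t sz ts o => [|a [|b []]] //= _ ts.
by rewrite same_order21; exists a, b.
Qed.

Lemma contains132P (s : seq nat) :
  reflect (exists a c b, subseq [:: a; c; b] s /\ a < b < c)
    (contains [:: 1; 3; 2] s).
Proof.
apply: (iffP (containsP _ _)) => [[t ts o]|[a [c [b [sub lt]]]]]; last first.
  by exists [:: a; c; b]; rewrite ?same_order132.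
have/andP[/eqP sz _] := o; case: t sz ts o => [|a [|c [|b []]]] //= _ ts.
by rewrite same_order132; exists a, c, b.
Qed.

Lemma contains2314P (s : seq nat) :
  reflect (exists u v z x, subseq [:: u; v; z; x] s /\ [&& z < u, u < v & v < x])
    (contains [:: 2; 3; 1; 4] s).
Proof.
apply: (iffP (containsP _ _)) => [[t ts o]|[u [v [z [x [sub lt]]]]]]; last first.
  by exists [:: u; v; z; x]; rewrite ?same_order2314.
have/andP[/eqP sz _] := o; case: t sz ts o => [|u [|v [|z [|x []]]]] //= _ ts.
by rewrite same_order2314; exists u, v, z, x.
Qed.

(** The mesh pattern read on letters instead of positions: a letter e that
    fills the square (0, 2) precedes a, and the squares (2, 0) and (2, 1) are
    empty exactly when the letters between c and b exceed b.  This is faithful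
    for words with distinct positive letters, see [mesh_avoids_muP]. *)
Definition mu_free (w : seq nat) := forall a c b,
  subseq [:: a; c; b] w -> a < b < c ->
  (forall e, subseq [:: c; e; b] w -> b < e) ->
  exists2 e, before w e a & b < e < c.

Definition free2314 (w : seq nat) := forall u v z x,
  subseq [:: u; v; z; x] w -> ~~ [&& z < u, u < v & v < x].

(** * The stack avoiding 21 *)

Lemma push_perm (tau st o s : seq nat) (x : nat) :
  push tau x st = (o, s) -> perm_eq (o ++ s) (x :: st).
Proof.
elim: st o s => [|y st IH] o s /=; first by case=> <- <-.
case: ifP => _; first by case=> <- <-.
case E: (push tau x st) => [o' s'] [<- <-] /=.
by rewrite -cat1s perm_sym (perm_catCA [:: x] [:: y]) perm_cons perm_sym IH.
Qed.

Lemma run_stack_perm (tau st s : seq nat) :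
  perm_eq (run_stack tau st s) (st ++ s).
Proof.
elim: s st => [|x s IH] st /=; first by rewrite cats0.
case E: (push tau x st) => [o s'].
rewrite (perm_trans (perm_cat (perm_refl o) (IH s'))) // catA.
by rewrite (perm_trans (perm_cat (push_perm E) (perm_refl s))) //= perm_sym perm_catC
  /= perm_cons perm_catC.
Qed.

(** * Runs of the stack avoiding 21 on a word with an increasing tail *)

Notation increasing := (pairwise ltn).
Notation decreasing := (pairwise gtn).

Lemma avoids21_increasing (s : seq nat) : increasing s -> avoids [:: 2; 1] s.
Proof.
move=> inc; apply/negP => /contains21P[a [b [sub lt]]].
by move: (subseq_pairwise sub inc); rewrite /= !andbT; lia.
Qed.

Lemma push21 (x : nat) (st : seq nat) : increasing st -> x \notin st ->
  exists P R, [/\ st = P ++ R, push [:: 2; 1] x st = (P, x :: R),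
    {in P, forall y, y < x} & {in R, forall y, x < y}].
Proof.
elim: st => [|y st IH] /=; first by exists [::], [::].
move=> /andP[y_st inc_st]; rewrite inE negb_or => /andP[xy xst].
have [yx|xy'] := ltnP y x.
  have [P [R [-> -> PP RR]]] := IH inc_st xst.
  exists (y :: P), R; split=> //; last by move=> z; rewrite inE => /predU1P[->|/PP].
  rewrite ifN //; apply/negPn/contains21P; exists x, y; split=> //.
  by rewrite /before /= !eqxx sub0seq.
have x_st : all (ltn x) (y :: st).
  rewrite /= ltn_neqAle xy xy' /=; apply: sub_all y_st => z /=; lia.
exists [::], (y :: st); split=> //; last by apply/allP.
by rewrite avoids21_increasing // pairwise_cons x_st /= y_st.
Qed.

(** The letters popped by x are smaller than x, which is smaller than all the
    remaining input: the run merges the stack with its input. *)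
Lemma run21_increasing (st ms : seq nat) : uniq (st ++ ms) ->
  increasing st -> increasing ms -> increasing (run_stack [:: 2; 1] st ms).
Proof.
elim: ms st => [|x ms IH] st //= us inc_st /andP[x_ms inc_ms].
have xst : x \notin st.
  by move: us; rewrite cat_uniq /= negb_or => /and3P[_ /andP[]].
have [P [R [e -> Px xR]]] := push21 inc_st xst; rewrite e in us inc_st.
move: inc_st us; rewrite !pairwise_cat => /and3P[PR incP incR].
rewrite -catA cat_uniq => /and3P[_ _ us].
have usR : uniq ((x :: R) ++ ms) by rewrite -cat1s -catA uniq_catCA.
have incxR : increasing (x :: R) by rewrite pairwise_cons incR andbT; apply/allP.
rewrite incP IH //= andbT.
apply/allrelP => y z yP; rewrite (perm_mem (run_stack_perm _ _ _)) mem_cat inE.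
case/orP=> [/predU1P[->|zR]|zms]; first exact: Px.
  exact: (allrelP PR).
by apply: (ltn_trans (Px _ yP)); apply: (allP x_ms).
Qed.

Lemma run21_decreasing (st d ms : seq nat) : increasing (rev d ++ st) ->
  run_stack [:: 2; 1] st (d ++ ms) = run_stack [:: 2; 1] (rev d ++ st) ms.
Proof.
elim: d st => [|x d IH] st //=; rewrite rev_cons cat_rcons => inc.
have ->: push [:: 2; 1] x st = ([::], x :: st).
  case: st inc => [|y st] //= inc; rewrite avoids21_increasing //.
  by move: inc; rewrite pairwise_cat => /and3P[].
exact: IH.
Qed.

(** An element that pops a smaller stack entry makes it leave before the
    minimum, which is still to come. *)
Lemma run21_not_decreasing (st d ms : seq nat) (m : nat) : m \in ms ->
  {in st ++ d, forall y, m < y} -> uniq (st ++ d) -> increasing st ->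
  increasing (run_stack [:: 2; 1] st (d ++ ms)) -> increasing (rev d ++ st).
Proof.
move=> m_ms; elim: d st => [|x d IH] st //= gt us inc.
have ud : perm_eq (x :: st ++ d) (st ++ x :: d) by rewrite -cat1s perm_catCA.
rewrite rev_cons cat_rcons.
have xst : x \notin st.
  by move: us; rewrite cat_uniq /= negb_or => /and3P[_ /andP[]].
have [[|y P] [R [e -> Px xR]]] := push21 inc xst.
  rewrite /= in e; rewrite -{}e /= in xR *; apply: IH => /=.
  - by move=> z; rewrite (perm_mem ud) => /gt.
  - by have := perm_uniq ud; rewrite us /= => ->.
  - by rewrite inc andbT; apply/allP.
rewrite cat_cons pairwise_cons => /andP[/allP/(_ m)/=].
rewrite mem_cat (perm_mem (run_stack_perm _ _ _)) !mem_cat m_ms !orbT => /(_ isT) ym.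
by have := gt y; rewrite e /= mem_head => /(_ isT); lia.
Qed.

Lemma run21_sorts (d ms : seq nat) : uniq (d ++ ms) -> increasing ms ->
  {in d, forall y, has (gtn y) ms} ->
  increasing (stack_sort [:: 2; 1] (d ++ ms)) = decreasing d.
Proof.
move=> us inc_ms gt_d; have rev_d : decreasing d = increasing (rev d).
  elim: d {us gt_d} => //= x d ->; rewrite rev_cons -cats1 pairwise_cat /= andbT.
  by rewrite allrel1r -all_rev.
rewrite rev_d; apply/idP/idP => inc.
  case: ms inc_ms gt_d us inc => [|m ms] inc_ms gt_d us inc.
    by case: d gt_d {us inc rev_d} => // x d /(_ x (mem_head _ _)).
  have := @run21_not_decreasing [::] d (m :: ms) m; rewrite cats0; apply=> //.
  - exact: mem_head.
  - move=> y /= /gt_d/hasP[z]; rewrite inE => /predU1P[->//|z_ms /=].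
    by move: inc_ms => /andP[/allP/(_ z z_ms)/= mz _]; apply: ltn_trans.
  - by move: us; rewrite cat_uniq => /and3P[].
rewrite /stack_sort run21_decreasing cats0 //; apply: run21_increasing => //.
by have/perm_uniq -> : perm_eq (rev d ++ ms) (d ++ ms) by rewrite perm_cat2r perm_rev.
Qed.

(** The output is a rearrangement of the input, so being sorted is enough for
    it to be the identity. *)
Lemma sortable_increasing (tau w : seq nat) : perm_eq w (iota 1 (size w)) ->
  sortable tau w = increasing (stack_sort [:: 2; 1] (stack_sort tau w)).
Proof.
move=> pw; rewrite /sortable -(sorted_pairwise ltn_trans).
apply/eqP/idP => [->|s]; first exact: iota_ltn_sorted.
apply: (irr_sorted_eq ltn_trans ltnn s (iota_ltn_sorted _ _)).
apply: perm_mem; apply: (perm_trans (run_stack_perm _ _ _)).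
exact: (perm_trans (run_stack_perm tau [::] w) pw).
Qed.

(** * The stack avoiding 132 *)

(** The action of [push [:: 1; 3; 2] x] on the body st of a stack st ++ ms
    when the pops stop before ms, as they do for increasing ms
    ([push132_body]). *)
Fixpoint body_push (x : nat) (st ms : seq nat) : seq nat * seq nat :=
  if st is y :: st' then
    if avoids [:: 1; 3; 2] (x :: st ++ ms) then ([::], x :: st)
    else let: (out, st'') := body_push x st' ms in (y :: out, st'')
  else ([::], [:: x]).

Lemma body_push_split (x : nat) (st ms o s : seq nat) :
  body_push x st ms = (o, s) -> exists2 r, s = x :: r & st = o ++ r.
Proof.
elim: st o s => [|y st IH] o s /=; first by case=> <- <-; exists [::].
case: ifP => _; first by case=> <- <-; exists (y :: st).
by case: (body_push x st ms) IH => o' s' /(_ _ _ erefl)[r -> ->] [<- <-]; exists r.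
Qed.

Lemma avoids132_cons_increasing (x : nat) (ms : seq nat) :
  increasing ms -> avoids [:: 1; 3; 2] (x :: ms).
Proof.
move=> inc; apply/negP => /contains132P[a [c [b [sub lt]]]].
have sub' : subseq [:: c; b] ms.
  move: sub => /=; case: eqP => // _ sub.
  by apply: subseq_trans sub; apply: (subseq_cons [:: c; b]).
by move: (subseq_pairwise sub' inc); rewrite /= !andbT; lia.
Qed.

Lemma push132_body (x : nat) (st ms : seq nat) : increasing ms ->
  push [:: 1; 3; 2] x (st ++ ms) =
  ((body_push x st ms).1, (body_push x st ms).2 ++ ms).
Proof.
move=> inc; elim: st => [|y st IH] /=.
  by case: ms inc => //= m ms inc; rewrite avoids132_cons_increasing.
by case: ifP => //; rewrite IH; case: (body_push x st ms).
Qed.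

(** For y in st, the letters x, y, m form an occurrence of 132. *)
Lemma push132_min (x m : nat) (st ms : seq nat) : increasing (x :: m :: ms) ->
  {in st, forall y, m < y} ->
  push [:: 1; 3; 2] x (st ++ m :: ms) = (st, [:: x, m & ms]).
Proof.
move=> inc; elim: st => [|y st IH] gt /=.
  by rewrite avoids132_cons_increasing //; case/andP: inc.
rewrite ifN; first by rewrite IH // => z zst; apply: gt; rewrite inE zst orbT.
apply/negPn/contains132P; exists x, y, m; split; last first.
  by rewrite gt ?mem_head // andbT; case/andP: inc => /andP[].
rewrite /= !eqxx sub1seq mem_cat mem_head orbT //.
Qed.

(** Since st is decreasing and ms increasing, a forbidden occurrence x c b has c
    in st, and b in st or ms.  A popped entry is thus always larger than x, and
    the lowest entry of st larger than x is popped exactly when b can be taken in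
    ms.  It is also the smallest entry larger than x, so b serves for the others
    too. *)
Lemma body_push_decreasing (x : nat) (st ms o s : seq nat) :
  decreasing st -> increasing ms -> uniq (x :: st ++ ms) ->
  body_push x st ms = (o, s) ->
  decreasing (o ++ s) <->
  (forall y, y \in st -> x < y -> has (fun m => x < m < y) ms).
Proof.
move=> dec inc; elim: st o s dec => [|y st IH] o s; first by move=> _ _ [<- <-].
rewrite pairwise_cons => /andP[/allP/= st_y dec].
rewrite inE negb_or => /and3P[/andP[xy xst] yst us].
case: ifP => [av|/negbFE/contains132P[a [c [b [sub lt]]]]].
  case=> <- <-; rewrite /= -!andbA dec andbT; split=> [/and3P[yx st_x _] z|h].
    move=> z_st; have zx : z < x.
      by move: z_st; rewrite inE => /predU1P[->//|/st_y zy]; apply: ltn_trans yx.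
    by rewrite ltnNge (ltnW zx).
  have yx : y < x.
    have [//|xy'] := ltnP y x; have xy2 : x < y by rewrite ltn_neqAle xy xy'.
    have /hasP[m m_ms xmy] := h y (mem_head _ _) xy2.
    case/negP: av; apply/contains132P; exists x, y, m; split=> //.
    by rewrite /= !eqxx sub1seq mem_cat m_ms orbT.
  by rewrite yx /=; apply/andP; split; apply/allP => z /st_y /= ?; lia.
case/andP: lt => ab bc; case E: (body_push x st ms) => [o' s'] [<- <-].
have [r es est] := body_push_split E.
have {IH} IH := IH o' s' dec _ E; rewrite /= xst us in IH; have {}IH := IH isT.
have decy : decreasing (y :: st) by rewrite pairwise_cons dec andbT; apply/allP.
have dec_before u v : before (y :: st) u v -> v < u.
  by move=> uv; move: (subseq_pairwise uv decy); rewrite /= !andbT.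
have inc_before u v : before ms u v -> u < v.
  by move=> uv; move: (subseq_pairwise uv inc); rewrite /= !andbT.
have cb : before ((y :: st) ++ ms) c b.
  move: sub; rewrite -cat_cons subseq_cons_cons; case: eqP => // _ sub.
  by apply: (cons_subseq sub).
have {cb} [c_st b_st] : c \in y :: st /\ (b \in st) || (b \in ms).
  move: cb; rewrite before_cat => /or3P[cb|/andP[-> ->]|/inc_before].
    have /andP[-> bst] := before_mem cb; split=> //.
    move: bst (dec_before _ _ cb); rewrite inE => /predU1P[->|-> //].
    move: (before_mem cb); rewrite inE => /andP[/predU1P[->|/st_y cy _ yc]].
      by rewrite ltnn.
    by have := ltn_trans yc cy; rewrite ltnn.
  - by rewrite orbT.
  by rewrite ltnNge (ltnW bc).
have ax : a = x.
  move: sub; rewrite -cat_cons subseq_cons_cons; case: eqP => // _ sub.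
  have : before ((y :: st) ++ ms) a c.
    by apply: subseq_trans sub; rewrite /= !eqxx.
  have cms : c \notin ms.
    apply: contraL c_st => cms; rewrite inE negb_or.
    move: yst us; rewrite mem_cat negb_or cat_uniq => /andP[_ yms].
    case/and3P=> [_ /hasPn/(_ c cms) -> _].
    by rewrite andbT; apply: contraNneq yms => <-.
  rewrite before_cat (negbTE cms) andbF => /orP[/dec_before|/before_mem/andP[_]].
    by rewrite ltnNge (ltnW (ltn_trans ab bc)).
  by rewrite (negbTE cms).
have c_y : c <= y by move: c_st; rewrite inE => /predU1P[->|/st_y/ltnW].
have xb : x < b by rewrite -ax.
have by' : b < y := leq_trans bc c_y.
have xy' : x < y := ltn_trans xb by'.
rewrite cat_cons pairwise_cons (_ : all _ _ = true); last first.
  rewrite es; apply/allP => z; rewrite mem_cat inE => zos.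
  have : z \in x :: st by rewrite inE est mem_cat; case/or3P: zos => ->; rewrite ?orbT.
  by rewrite inE => /predU1P[->|/st_y].
rewrite andTb; split=> [/IH h z|h]; last first.
  by apply/IH => z zst; apply: h; rewrite inE zst orbT.
rewrite inE => /predU1P[-> _|/h //].
case/orP: b_st => [/h/(_ xb)/hasP[m m_ms /andP[xm mb]]|b_ms].
  by apply/hasP; exists m => //; rewrite xm (ltn_trans mb).
by apply/hasP; exists b => //; rewrite xb.
Qed.

(** * Adding a last letter *)

(** No occurrence of the pattern in p followed by x ends with the letter x. *)
Definition free2314_last (p : seq nat) (x : nat) := forall u v z,
  subseq [:: u; v; z] p -> ~~ [&& z < u, u < v & v < x].

Definition mu_free_last (p : seq nat) (x : nat) := forall a c,
  before p a c -> a < x < c -> (forall e, before p c e -> x < e) ->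
  exists2 e, before p e a & x < e < c.

Lemma free2314_rcons (p : seq nat) (x : nat) :
  free2314 (rcons p x) <-> free2314 p /\ free2314_last p x.
Proof.
split=> [free|[free last] u v z y].
  split=> [u v z y sub|u v z sub]; apply: free.
    exact: subseq_trans sub (subseq_rcons _ _).
  by rewrite (subseq_rcons2 [:: u; v; z]) eqxx sub orbT.
rewrite (subseq_rcons2 [:: u; v; z]) => /orP[/free //|/andP[/eqP-> ]].
exact: last.
Qed.

Lemma mu_free_rcons (p : seq nat) (x : nat) : uniq (rcons p x) ->
  mu_free (rcons p x) <-> mu_free p /\ mu_free_last p x.
Proof.
rewrite rcons_uniq => /andP[xp up].
have beforeK y z : z \in p -> before (rcons p x) y z = before p y z.
  by move=> zp; rewrite before_rcons; case: eqP xp => [<-|]; rewrite ?zp ?orbF.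
have sub3 a c b : subseq [:: a; c; b] (rcons p x) =
    subseq [:: a; c; b] p || (b == x) && before p a c.
  by rewrite (subseq_rcons2 [:: a; c]).
split=> [free|[free last] a c b].
  split=> [a c b sub lt no|a c ac lt no].
    have /and4P[/= ap _ bp _] : all [in p] [:: a; c; b] by apply/allP/mem_subseq.
    have sub' : subseq [:: a; c; b] (rcons p x) by rewrite sub3 sub.
    have [e|e ea lt_e] := free a c b sub' lt.
      by rewrite sub3 => /orP[/no //|/andP[/eqP bx]]; rewrite -bx bp in xp.
    by exists e; rewrite -?(beforeK _ _ ap).
  have /andP[ap _] := before_mem ac.
  have sub' : subseq [:: a; c; x] (rcons p x) by rewrite sub3 eqxx ac orbT.
  have [e|e ea lt_e] := free a c x sub' lt.
    rewrite sub3 eqxx => /orP[/mem_subseq/(_ x)|/no //].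
    by rewrite !inE eqxx !orbT (negbTE xp) => /(_ isT).
  by exists e; rewrite -?(beforeK _ _ ap).
have wide y z : before p y z -> before (rcons p x) y z.
  by rewrite before_rcons => ->.
rewrite sub3 => /orP[sub|/andP[/eqP-> ac]] lt no.
  have [e sub_e|e ea lt_e] := free a c b sub lt; last by exists e => //; apply: wide.
  by apply: no; rewrite sub3 sub_e.
have [e sub_e|e ea lt_e] := last a c ac lt; last by exists e => //; apply: wide.
by apply: no; rewrite sub3 eqxx sub_e orbT.
Qed.

(** * States of the stack avoiding 132 *)

(** [reach p out st ms]: after reading p, the output is out and the stack is
    st ++ ms.  The two ways to read a letter are separated according to whether
    it is a left-to-right minimum; [reach_foldl] justifies this description. *)
Inductive reach : seq nat -> seq nat -> seq nat -> seq nat -> Prop :=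
| reach_nil : reach [::] [::] [::] [::]
| reach_min p out st ms x : reach p out st ms -> all (ltn x) p ->
    reach (rcons p x) (out ++ st) [::] (x :: ms)
| reach_body p out st ms x o s : reach p out st ms -> has (gtn x) p ->
    body_push x st ms = (o, s) -> reach (rcons p x) (out ++ o) s ms.

Definition left_min (p : seq nat) (y : nat) :=
  (y \in p) && all (fun u => before p u y ==> (y < u)) p.

Lemma left_minP (p : seq nat) (y : nat) :
  reflect (y \in p /\ forall u, before p u y -> y < u) (left_min p y).
Proof.
apply: (iffP andP) => -[yp h]; split=> //.
  move=> u uy; apply: (implyP (allP h u _)) => //.
  by case/andP: (before_mem uy).
by apply/allP => u _; apply/implyP/h.
Qed.

Lemma left_minPn (p : seq nat) (y : nat) : uniq p -> y \in p ->
  ~~ left_min p y -> exists2 u, before p u y & u < y.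
Proof.
move=> up yp; rewrite /left_min yp /= => /allPn[u _]; rewrite negb_imply -leqNgt.
by case/andP=> uy le; exists u; rewrite // ltn_neqAle le (before_neq up uy).
Qed.

Lemma left_min_below (p : seq nat) (e : nat) : uniq p -> e \in p ->
  exists m, [/\ left_min p m, m <= e & m = e \/ before p m e].
Proof.
move=> up; elim/ltn_ind: e => e IH ep.
have [e_min|/(left_minPn up ep)[u ue lt]] := boolP (left_min p e).
  by exists e; split=> //; left.
have /andP[u_p _] := before_mem ue.
have [m [m_min le mu']] := IH u lt u_p; exists m; split=> //; first lia.
by right; case: mu' => [->|mu'] //; apply: before_trans mu' ue.
Qed.

Lemma reach_perm p out st ms : reach p out st ms -> perm_eq (out ++ st ++ ms) p.
Proof.
elim=> {p out st ms} // [p out st ms x _ IH _|p out st ms x o s _ IH _ e];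
  apply/seq.permP => a; move/seq.permP/(_ a): IH; first by rewrite -cats1 !count_cat /=; lia.
by have [r -> ->] := body_push_split e; rewrite -cats1 !count_cat /=; lia.
Qed.

Lemma reach_uniq p out st ms :
  reach p out st ms -> uniq p -> uniq (out ++ st ++ ms).
Proof. by move=> /reach_perm/perm_uniq->. Qed.

Lemma reach_mins p out st ms : reach p out st ms -> uniq p ->
  increasing ms /\ ms =i left_min p.
Proof.
elim=> {p out st ms} // [p out st ms x R IH lt|p out st ms x o s R IH gt _];
  rewrite rcons_uniq => /andP[xp up]; have [inc mins] := IH up.
- have xms : all (ltn x) ms.
    apply/allP => m; rewrite mins => /left_minP[m_p _]; exact: (allP lt).
  rewrite pairwise_cons xms inc; split=> // y; rewrite inE mins.
  apply/orP/left_minP => [[/eqP->|/left_minP[yp y_min]]|[]].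
  + rewrite mem_rcons mem_head; split=> // u; rewrite before_rcons eqxx /=.
    case/orP=> [/before_mem|/(allP lt) //]; by rewrite (negbTE xp) andbF.
  + rewrite mem_rcons inE yp orbT; split=> // u; rewrite before_rcons.
    by case/orP=> [/y_min //|/andP[/eqP e]]; rewrite -e yp in xp.
  rewrite mem_rcons inE => /predU1P[->|yp] y_min; [by left|right; apply/left_minP].
  by split=> // u uy; apply: y_min; rewrite before_rcons uy.
split=> // y; rewrite mins; apply/left_minP/left_minP => -[].
  move=> yp y_min; rewrite mem_rcons inE yp orbT; split=> // u; rewrite before_rcons.
  by case/orP=> [/y_min //|/andP[/eqP e]]; rewrite -e yp in xp.
rewrite mem_rcons inE => /predU1P[->|yp] y_min.
  case/hasP: gt => u u_p /=; have := y_min u; rewrite before_rcons eqxx u_p orbT => /(_ isT); lia.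
by split=> // u uy; apply: y_min; rewrite before_rcons uy.
Qed.

Lemma reach_has_min p out st ms y : reach p out st ms -> uniq p ->
  y \in out ++ st -> has (gtn y) ms.
Proof.
move=> R up y_os; have [_ mins] := reach_mins R up.
have yp : y \in p by rewrite -(perm_mem (reach_perm R)) catA mem_cat y_os.
have [m [m_min le _]] := left_min_below up yp; apply/hasP; exists m; rewrite ?mins //=.
rewrite ltn_neqAle le andbT; apply: contraTneq y_os => <-.
have := reach_uniq R up; rewrite catA cat_uniq => /and3P[_ /hasPn + _]; apply.
by rewrite mins.
Qed.

(** * The first stack *)

(** One step of the stack, on pairs made of the output and the stack: the word
    is consumed from the left, so that prefixes of the input make sense. *)
Definition step (tau : seq nat) (os : seq nat * seq nat) (x : nat) :=
  let: (o, s) := push tau x os.2 in (os.1 ++ o, s).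

Lemma run_stack_foldl (tau out st w : seq nat) :
  out ++ run_stack tau st w =
  (foldl (step tau) (out, st) w).1 ++ (foldl (step tau) (out, st) w).2.
Proof.
elim: w out st => [|x w IH] out st //=; rewrite {2 4}/step /=.
by case: (push tau x st) => o s; rewrite catA IH.
Qed.

Lemma reach_foldl p out st ms : reach p out st ms -> uniq p ->
  foldl (step [:: 1; 3; 2]) ([::], [::]) p = (out, st ++ ms).
Proof.
elim=> {p out st ms} // [p out st ms x R IH lt|p out st ms x o s R IH gt e];
  rewrite rcons_uniq foldl_rcons => /andP[xp up]; rewrite IH // /step /=;
  have [inc mins] := reach_mins R up.
  have st_ms y : y \in st -> has (gtn y) ms.
    by move=> y_st; apply: (reach_has_min R up); rewrite mem_cat y_st orbT.
  case: ms R inc mins st_ms {IH} => [|m ms] R inc mins st_ms.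
    by case: st st_ms {R} => [|y st /(_ y (mem_head _ _))].
  rewrite push132_min // => [|y /st_ms/hasP[m']].
    rewrite pairwise_cons inc andbT; apply/allP => m'.
    by rewrite mins => /left_minP[m_p _]; apply: (allP lt).
  rewrite inE => /predU1P[-> //|m'_ms]; apply: ltn_trans.
  by case/andP: inc => /allP/(_ _ m'_ms).
by rewrite push132_body // e.
Qed.

Lemma reach_exists w : uniq w -> exists out st ms, reach w out st ms.
Proof.
elim/last_ind: w => [|p x IH].
  by exists [::], [::], [::]; apply: reach_nil.
rewrite rcons_uniq => /andP[xp /IH[out [st [ms R]]]].
have [lt|/allPn[u u_p]] := boolP (all (ltn x) p).
  by exists (out ++ st), [::], (x :: ms); apply: reach_min.
rewrite /= -leqNgt leq_eqVlt => /predU1P[ux|ux]; first by rewrite -ux u_p in xp.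
case E: (body_push x st ms) => [o s].
by exists (out ++ o), s, ms; apply: reach_body R _ E; apply/hasP; exists u.
Qed.

(** * States with a decreasing output and body *)

Lemma reach_not_min p out st ms y : reach p out st ms -> uniq p ->
  y \in out ++ st -> exists2 u, before p u y & u < y.
Proof.
move=> R up y_os; have [_ mins] := reach_mins R up.
have yp : y \in p by rewrite -(perm_mem (reach_perm R)) catA mem_cat y_os.
apply: left_minPn => //; have := reach_uniq R up.
rewrite catA cat_uniq => /and3P[_ /hasPn ms_os _].
by apply: contraL y_os => y_min; apply: ms_os; rewrite mins.
Qed.

Lemma body_push_subseq x st ms o s :
  body_push x st ms = (o, s) -> subseq st (o ++ s).
Proof.
by case/body_push_split=> r -> ->; rewrite cat_subseq // subseq_cons.
Qed.

(** A new letter x pops the entries larger than x, which now have a smaller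
    letter after them, and is put above smaller entries only. *)
Lemma reach_later p out st ms : reach p out st ms -> uniq p ->
  decreasing (out ++ st) ->
  (forall y z, y \in st -> before p y z -> y < z) /\
  (forall y, y \in out -> exists2 z, before p y z & z < y).
Proof.
elim=> {p out st ms} // [p out st ms x R IH lt|p out st ms x o s R IH gt e];
  rewrite rcons_uniq => /andP[xp up] dec.
- rewrite cats0 in dec; have [later_st later_out] := IH up dec; split=> // y.
  rewrite mem_cat => /orP[/later_out[z yz lt_z]|y_st].
    by exists z; rewrite // before_rcons yz.
  have yp : y \in p by rewrite -(perm_mem (reach_perm R)) !mem_cat y_st orbT.
  by exists x; [rewrite before_rcons eqxx yp orbT | apply: (allP lt)].
have [later_st later_out] : (forall y z, y \in st -> before p y z -> y < z) /\
  (forall y, y \in out -> exists2 z, before p y z & z < y).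
  apply: IH => //; apply: subseq_pairwise dec.
  by rewrite -catA cat_subseq // (body_push_subseq e).
have st_p y : y \in st -> y \in p.
  by move=> y_st; rewrite -(perm_mem (reach_perm R)) !mem_cat y_st orbT.
have [r es est] := body_push_split e.
move: dec; rewrite -catA pairwise_cat => /and3P[_ _].
rewrite es pairwise_cat allrel_consr => /and3P[/andP[/allP/= o_x _] _ /andP[/allP/= r_x _]].
split=> y => [z|].
  rewrite inE before_rcons => /predU1P[->|yr].
    by rewrite (negbTE xp) andbF orbF => /before_mem; rewrite (negbTE xp).
  case/orP=> [|/andP[/eqP-> _]]; last exact: r_x.
  by apply: later_st; rewrite est mem_cat yr orbT.
rewrite mem_cat => /orP[/later_out[z yz lt_z]|yo].
  by exists z; rewrite // before_rcons yz.
have y_st : y \in st by rewrite est mem_cat yo.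
by exists x; [rewrite before_rcons eqxx st_p ?orbT | apply: o_x].
Qed.

(** If x enters correctly, then in 2 3 1 x the letter 3 is already output, which
    forces 3 > x; and for a mesh occurrence a c x, the smallest letter y from c
    on is still on the stack, so that some left-to-right minimum lies between
    x and y in value, and precedes a since it exceeds a.

    Conversely, let y be in the output, u < y before it and z the smallest
    letter after it.  If y < x, then u y z x is an occurrence of 2314 when
    z < u.  Otherwise u y z is a 132, and avoiding mu provides w before u
    with z < w < y, so that w y z x is an occurrence of 2314.  For y > x on
    the stack, let a be the first letter smaller than x.  Avoiding mu,
    applied to a y x, provides w before a with x < w < y, and a left-to-right
    minimum not after w and at most w also exceeds x, by the choice of a. *)
Lemma reach_decreasing p out st ms : reach p out st ms -> uniq p ->
  decreasing (out ++ st) <-> free2314 p /\ mu_free p.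
Proof.
elim=> {p out st ms} [_|p out st ms x R IH lt|p out st ms x o s R IH gt e]; first by split.
  rewrite rcons_uniq => /andP[xp up]; rewrite cats0 IH //.
  rewrite free2314_rcons mu_free_rcons ?rcons_uniq ?xp //.
  split=> [[free free']|[[free _] [free' _]]//]; split; split=> //.
    move=> u v z sub; have zp : z \in p by apply: (mem_subseq sub); rewrite !inE eqxx !orbT.
    have /= xz := allP lt z zp; apply/negP => /and3P[zu uv vx].
    by have := ltn_trans (ltn_trans xz zu) (ltn_trans uv vx); rewrite ltnn.
  move=> a c ac /andP[ax _]; have /andP[ap _] := before_mem ac.
  by have := ltn_trans ax (allP lt a ap); rewrite ltnn.
move=> uq; have := uq; rewrite rcons_uniq => /andP[xp up].
rewrite free2314_rcons mu_free_rcons //.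
have dec_st : decreasing ((out ++ o) ++ s) -> decreasing (out ++ st).
  move=> dec; apply: subseq_pairwise dec.
  by rewrite -catA cat_subseq // (body_push_subseq e).
suff main : decreasing (out ++ st) -> free2314 p /\ mu_free p ->
    decreasing ((out ++ o) ++ s) <-> free2314_last p x /\ mu_free_last p x.
  split=> [dec|[[f2 f2x] [fm fmx]]].
    have dst := dec_st dec; have fs := proj1 (IH up) dst.
    by have [f2x fmx] := proj1 (main dst fs) dec; case: fs.
  have fs : free2314 p /\ mu_free p by [].
  by apply/(main (proj2 (IH up) fs) fs).
move=> {IH dec_st} dec [f2 fm].
have [later_st later_out] := reach_later R up dec.
have not_min := reach_not_min R up; have [inc mins] := reach_mins R up.
have pE := perm_mem (reach_perm R).
have out_p y : y \in out -> y \in p by rewrite -pE mem_cat => ->.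
have st_p y : y \in st -> y \in p by rewrite -pE !mem_cat => ->; rewrite orbT.
have x_neq y : y \in p -> x != y by apply: contraTneq => <-.
have u_st : uniq (x :: st ++ ms).
  have := reach_uniq R up; rewrite cat_uniq /= => /and3P[_ _ ->].
  by rewrite andbT; apply: contra xp => x_st; rewrite -pE mem_cat x_st orbT.
have [r es est] := body_push_split e.
move: (dec); rewrite pairwise_cat => /and3P[out_st dec_out dec_st].
have stepE : decreasing ((out ++ o) ++ s) <->
    {in out, forall y, x < y} /\ (forall y, y \in st -> x < y -> has (fun m => x < m < y) ms).
  rewrite -(body_push_decreasing dec_st inc u_st e) -catA pairwise_cat dec_out.
  split=> [/and3P[/allrelP out_os _ ->]|[x_out ->]].
    by split=> // y y_out; apply: (out_os y x y_out); rewrite es mem_cat mem_head orbT.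
  rewrite !andbT; apply/allrelP => y z y_out z_os.
  have : z \in x :: st.
    rewrite inE est mem_cat; move: z_os; rewrite es mem_cat inE.
    by case/or3P=> ->; rewrite ?orbT.
  by rewrite inE => /predU1P[->|z_st]; [apply: x_out | apply: (allrelP out_st)].
rewrite stepE; split=> [[x_out x_st]|[f2x fmx]].
  split=> [u v z sub|a c ac /andP[ax xc] no].
    apply/negP => /and3P[zu uv vx].
    have uv_p : before p u v by apply: subseq_trans sub; rewrite /= !eqxx.
    have vz_p : before p v z by apply: subseq_trans sub; apply: (subseq_cons [:: v; z]).
    have /andP[u_p v_p] := before_mem uv_p.
    have : v \in out ++ st ++ ms by rewrite pE.
    rewrite !mem_cat mins => /or3P[/x_out|/later_st/(_ vz_p)|/left_minP[_ /(_ u uv_p)]].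
    - by rewrite ltnNge (ltnW vx).
    - by rewrite ltnNge (ltnW (ltn_trans zu uv)).
    by rewrite ltnNge (ltnW uv).
  have /andP[ap cp] := before_mem ac.
  have after_c : exists y, (y == c) || before p c y by exists c; rewrite eqxx.
  case: (ex_minnP after_c) => y y_c y_le.
  have yc : y <= c by apply: y_le; rewrite eqxx.
  have ay : before p a y by case/predU1P: y_c => [->|/(before_trans up ac)].
  have xy : x < y by case/predU1P: y_c => [->|/no].
  have y_later z : before p y z -> y < z.
    move=> yz; rewrite ltn_neqAle (before_neq up yz) y_le //; case/predU1P: y_c => [<-|cy].
      by rewrite yz orbT.
    by rewrite (before_trans up cy yz) orbT.
  have : y \in out ++ st ++ ms by rewrite pE; case/andP: (before_mem ay).
  rewrite !mem_cat mins => /or3P[/later_out[z /y_later yz]|y_st|/left_minP[_ /(_ a ay)]].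
  - by rewrite ltnNge (ltnW yz).
  - have /hasP[m] := x_st y y_st xy; rewrite mins => /left_minP[m_p m_min] /andP[xm my].
    exists m; last by rewrite xm (leq_trans my).
    have am : a < m := ltn_trans ax xm.
    have := before_total up ap m_p; rewrite neq_ltn am => /(_ isT)/orP[/m_min|//].
    by rewrite ltnNge (ltnW am).
  by rewrite ltnNge (ltnW (ltn_trans ax xy)).
split=> [y y_out|y y_st xy].
  rewrite ltnNge leq_eqVlt eq_sym (negbTE (x_neq y (out_p y y_out))) /=; apply/negP => yx.
  have [z0 yz0 z0y] := later_out y y_out.
  have [u uy lt_u] : exists2 u, before p u y & u < y by apply: not_min; rewrite mem_cat y_out.
  (* z is minimal after y, so nothing between y and z is smaller than z *)
  case: (ex_minnP (ex_intro (before p y) z0 yz0)) => z yz z_le.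
  have zy : z < y := leq_ltn_trans (z_le _ yz0) z0y.
  have below w : before p w y -> z < w < y -> False.
    move=> wy /andP[zw wy']; have := f2x w y z (before_glue up wy yz).
    by rewrite zw wy' yx.
  have [zu|uz] := ltnP z u; first by apply: (below u) => //; rewrite zu.
  have uz' : u < z by rewrite ltn_neqAle uz (before_neq up (before_trans up uy yz)).
  have [||w wu] := fm u y z (before_glue up uy yz); first by rewrite uz' zy.
    move=> w ywz; have yw : before p y w by apply: subseq_trans ywz; rewrite /= !eqxx.
    have wz : before p w z by apply: subseq_trans ywz; apply: (subseq_cons [:: w; z]).
    by rewrite ltn_neqAle eq_sym (before_neq up wz) z_le.
  by apply: below; apply: before_trans wu uy.
have [a [ap ax a_first]] := first_mem up gt.
have ay : before p a y.
  have lt_ay := ltn_trans ax xy.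
  have := before_total up ap (st_p y y_st); rewrite neq_ltn lt_ay.
  case/(_ isT)/orP=> [//|/(later_st _ _ y_st)].
  by rewrite ltnNge (ltnW lt_ay).
have [||w wa /andP[xw wy]] := fmx a y ay; first by apply/andP; split.
  by move=> w /(later_st _ _ y_st); apply: ltn_trans.
have /andP[wp _] := before_mem wa.
have [m [m_min mw m_before]] := left_min_below up wp.
apply/hasP; exists m; rewrite ?mins // (leq_ltn_trans mw wy) andbT.
have ma : before p m a by case: m_before => [->|/before_trans ->].
have := a_first m ma; have /andP[m_p _] := before_mem ma.
by rewrite /= -leqNgt leq_eqVlt (negbTE (x_neq m m_p)).
Qed.

(** * The mesh pattern and the sorting procedure *)

Lemma mask_nth (w : seq nat) (m : bitseq) :
  mask m w = [seq nth 0 w i | i <- mask m (iota 0 (size w))].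
Proof. by rewrite map_mask map_nth_iota0 // take_size. Qed.

Lemma mask_iota_ltn (n : nat) (m : bitseq) :
  sorted ltn (mask m (iota 0 n)) /\ all (gtn n) (mask m (iota 0 n)).
Proof.
split; first by apply: (subseq_sorted ltn_trans (mask_subseq _ _)); apply: iota_ltn_sorted.
by apply/allP => i /mem_mask; rewrite mem_iota.
Qed.

Lemma sort_leq3 (a c b : nat) : a < b < c -> sort leq [:: a; c; b] = [:: a; b; c].
Proof.
case/andP=> ab bc; apply: (sorted_eq leq_trans anti_leq); first exact: (sort_sorted leq_total).
  by rewrite /= (ltnW ab) (ltnW bc).
by rewrite perm_sort perm_cons (perm_catC [:: c] [:: b]).
Qed.

(** Letters and positions correspond by [index].  The squares (2, 0) and (2, 1)
    cover all values below b but 0 and the grid line a; neither value is taken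
    between c and b, since letters are positive and distinct. *)
Lemma mu_squaresP (w : seq nat) (m : bitseq) (a c b : nat) : uniq w ->
  {in w, forall y, 0 < y} -> mask m w = [:: a; c; b] -> a < b < c ->
  all (fun q => ~~ has (in_region w m q) (iota 1 (size w))) (mesh_squares mu) <->
  (forall e, before w e a -> ~~ (b < e < c)) /\
  (forall e, subseq [:: c; e; b] w -> b < e).
Proof.
move=> uw w_gt0 mE acb; have [] := mask_iota_ltn (size w) m.
have := mask_nth w m; rewrite mE.
have hE : hlines w m = [:: 0; a; b; c; (size w).+1] by rewrite /hlines mE sort_leq3.
have vE : vlines w m = 0 :: rcons [seq i.+1 | i <- mask m (iota 0 (size w))] (size w).+1.
  by rewrite /vlines -[1]addn0 iotaDl map_mask.
case: (mask m (iota 0 (size w))) vE => [|i [|j [|k []]]] //= vE.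
case=> a_i c_j b_k /and3P[ij jk _] /and4P[iw jw kw _].
have in_w l : l < size w -> nth 0 w l \in w by apply: mem_nth.
have afterE y l : l < size w -> before w y (nth 0 w l) = (index y w < l).
  by move=> lt; rewrite before_index // in_w // index_uniq.
have beforeE y l : l < size w -> before w (nth 0 w l) y = (y \in w) && (l < index y w).
  by move=> lt; rewrite before_index // index_uniq.
have midE e : subseq [:: c; e; b] w = (j < index e w < k).
  rewrite c_j b_k; apply/idP/idP => [sub|/andP[je ek]].
    have ce : before w (nth 0 w j) e by apply: subseq_trans sub; rewrite /= !eqxx.
    have eb : before w e (nth 0 w k).
      by apply: subseq_trans sub; apply: (subseq_cons [:: e; _]).
    by move: ce eb; rewrite afterE // beforeE // => /andP[_ ->] ->.
  have ew : e \in w by rewrite -index_mem (ltn_trans ek).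
  by apply: before_glue => //; rewrite ?afterE ?beforeE ?ew.
have region q l : in_region w m q l = [&& nth 0 [:: 0; i.+1; j.+1; k.+1; (size w).+1] q.1 < l,
    l < nth 0 [:: 0; i.+1; j.+1; k.+1; (size w).+1] q.1.+1,
    nth 0 [:: 0; a; b; c; (size w).+1] q.2 < nth 0 w l.-1 &
    nth 0 w l.-1 < nth 0 [:: 0; a; b; c; (size w).+1] q.2.+1].
  by rewrite /in_region hE vE -andbA.
rewrite andbT; split=> [/and3P[/hasPn r02 /hasPn r20 /hasPn r21]|[no_ac no_cb]].
  split=> [e|e]; [rewrite a_i afterE // => ei | rewrite midE => /andP[je ek]].
    have ew : e \in w by rewrite -index_mem (ltn_trans ei).
    have := r02 (index e w).+1; rewrite mem_iota /= add1n ltnS index_mem ew region /= nth_index //.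
    by rewrite ltnS ei => /(_ isT).
  have ew : e \in w by rewrite -index_mem (ltn_trans ek).
  have := r20 (index e w).+1; have := r21 (index e w).+1.
  rewrite mem_iota /= add1n ltnS index_mem ew !region /= nth_index // !ltnS je ek w_gt0 //=.
  move=> /(_ isT) r1 /(_ isT) r0.
  have e_b : e != b by apply: contraTneq ek => ->; rewrite b_k index_uniq // ltnn.
  have e_a : e != a.
    by apply: contraTneq je => ->; rewrite a_i index_uniq // -leqNgt ltnW.
  move: r0 r1; rewrite -leqNgt leq_eqVlt eq_sym (negbTE e_a) /= => ->.
  by rewrite -leqNgt leq_eqVlt eq_sym (negbTE e_b).
have below_b l : j < l < k -> b < nth 0 w l.
  move=> /andP[jl lk]; have lw := ltn_trans lk kw.
  by apply: no_cb; rewrite midE index_uniq // jl.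
apply/and3P; split; apply/hasPn => -[|l]; rewrite mem_iota // add1n ltnS region /= !ltnS => lw.
- apply: contraTN isT => /and3P[li ebc eb].
  have := no_ac (nth 0 w l); rewrite a_i afterE // index_uniq // => /(_ li).
  by rewrite ebc eb.
- rewrite andbA; apply: contraTN isT => /andP[/below_b be /andP[_ ea]].
  by have := ltn_trans be ea; case/andP: acb => ab _; rewrite ltnNge (ltnW ab).
rewrite andbA; apply: contraTN isT => /andP[/below_b be /andP[_ eb]].
by have := ltn_trans be eb; rewrite ltnn.
Qed.

Lemma mesh_avoids_muP (w : seq nat) : uniq w -> {in w, forall y, 0 < y} ->
  mesh_avoids mu w <-> mu_free w.
Proof.
move=> uw w_gt0; split=> [/existsPn no a c b sub acb no_cb|free].
  have /hasP[e ew /andP[ea bec]] : has (fun e => before w e a && (b < e < c)) w.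
    apply/negPn/negP => /hasPn no_ac; have /subseqP[m /eqP sm mE] := sub.
    have /negP := no (Tuple sm); apply; rewrite /mesh_occurrence /occurrence /= -mE.
    rewrite same_order132 acb; apply/(mu_squaresP uw w_gt0 (esym mE) acb).
    split=> // e ea; have /andP[ew _] := before_mem ea.
    by have := no_ac e ew; rewrite ea.
  by exists e.
apply/existsPn => m; apply/negP => /andP[occ].
have/andP[/eqP sz _] := occ; case E: (mask m w) sz occ => [|a [|c [|b []]]] //= _.
rewrite /occurrence E same_order132 => acb /(mu_squaresP uw w_gt0 E acb)[no_ac no_cb].
have sub : subseq [:: a; c; b] w by rewrite -E mask_subseq.
by have [e /no_ac/negP] := free a c b sub acb no_cb.
Qed.

Lemma avoids2314P (w : seq nat) : avoids [:: 2; 3; 1; 4] w <-> free2314 w.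
Proof.
split=> [/contains2314P no u v z x sub|free].
  by apply/negP => lt; apply: no; exists u, v, z, x.
by apply/contains2314P => -[u [v [z [x [/free/negP]]]]].
Qed.

Lemma sortable132 (w : seq nat) : perm_eq w (iota 1 (size w)) ->
  sortable [:: 1; 3; 2] w <-> free2314 w /\ mu_free w.
Proof.
move=> pw; have uw : uniq w by rewrite (perm_uniq pw) iota_uniq.
have [out [st [ms R]]] := reach_exists uw.
have := run_stack_foldl [:: 1; 3; 2] [::] [::] w; rewrite (reach_foldl R uw) /= catA.
rewrite sortable_increasing // -/(stack_sort _ w) => ->; have [inc _] := reach_mins R uw.
rewrite run21_sorts // -?catA ?(reach_uniq R uw) //; first exact: reach_decreasing R uw.
by move=> y; apply: reach_has_min R uw.
Qed.

Lemma word_perm (n : nat) (p : 'S_n) : perm_eq (word p) (iota 1 (size (word p))).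
Proof.
have uw : uniq (word p).
  by rewrite map_inj_uniq ?enum_uniq // => i j [/val_inj/perm_inj].
rewrite size_map -cardE card_ord; apply: uniq_perm; rewrite ?iota_uniq //.
have sub : {subset word p <= iota 1 n}.
  by move=> _ /mapP[i _ ->]; rewrite mem_iota add1n !ltnS ltn_ord.
by apply: (uniq_min_size uw sub _).2; rewrite size_iota size_map -cardE card_ord.
Qed.

Theorem corollary3p5 (n : nat) :
  Sort n [:: 1; 3; 2] = Av n [:: 2; 3; 1; 4] mu.
Proof.
apply/setP => p; rewrite !inE; have pw := word_perm p.
have uw : uniq (word p) by rewrite (perm_uniq pw) iota_uniq.
have w_gt0 : {in word p, forall y, 0 < y} by move=> y /mapP[i _ ->].
apply/idP/andP => [/(sortable132 pw)[free2 free_mu]|[/avoids2314P free2 av_mu]].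
  by split; [apply/avoids2314P | apply/(mesh_avoids_muP uw w_gt0)].
by apply/(sortable132 pw); split=> //; apply/(mesh_avoids_muP uw w_gt0).
Qed.
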